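(* Let $R\colon\mathrm{iComp}\to\mathrm{Comp}$ be the right adjoint of the inclusion of ordinary computads into computads with invertible generators. For every computad with invertible generators $C$, the weak $\omega$-category $K(C)$ generated by $C$ is isomorphic (in $\mathrm{Cat}_\omega$) to the weak $\omega$-category $K(RC)$ generated by the ordinary computad $RC$.
   Context: GLOBULAR SETS. For $n\in\mathbb N\cup\{-1,\omega\}$, an $n$-globular set $X$ consists of sets $X_k$ (of $k$-cells) for natural numbers $k\le n$ and functions $s_k,t_k\colon X_{k+1}\to X_k$ with $s_ks_{k+1}=s_kt_{k+1}$ and $t_ks_{k+1}=t_kt_{k+1}$. They form a presheaf category $\mathrm{gSet}_n$ (terminal for $n=-1$); $\mathrm{gSet}=\mathrm{gSet}_\omega$; $\mathrm{tr}_m$ denotes truncation. An $n$-globular set is regarded as a globular set without cells above dimension $n$. $\mathrm{Par}_n(X)$ is the set of pairs $(a,b)$ of parallel $n$-cells ($n=0$, or $a,b$ have the same source and the same target); $(a,b)^{\mathrm{op}}=(b,a)$. $\mathbb D^n$ is the representable globular set on $n$ and $\mathbb S^{n-1}\subset\mathbb D^n$ is obtained by removing its unique $n$-cell. PASTING DIAGRAMS. The suspension $\Sigma X$ has $(\Sigma X)_0=\{\sigma,\tau\}$, $(\Sigma X)_{n+1}=X_n$, every $1$-cell having source $\sigma$ and target $\tau$; its chosen $0$-cells are $\sigma,\tau$. For globular sets with two chosen $0$-cells (first and last), the wedge sum $X\vee Y$ glues the last $0$-cell of $X$ to the first of $Y$; the empty wedge is $\mathbb D^0$. Batanin trees are defined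 inductively: $\mathrm{br}[B_1,\dots,B_n]$ is a tree for every finite list of trees. $\dim\mathrm{br}[B_1,\dots,B_n]=\max_i(\dim B_i+1)$ ($0$ for the empty list); $\partial_0B=\mathrm{br}[\,]$, $\partial_{k+1}\mathrm{br}[B_1,\dots,B_n]=\mathrm{br}[\partial_kB_1,\dots,\partial_kB_n]$. $\mathrm{Pos}(\mathrm{br}[B_1,\dots,B_n])=\Sigma\mathrm{Pos}(B_1)\vee\dots\vee\Sigma\mathrm{Pos}(B_n)$. The maps $\sigma_k^B,\tau_k^B\colon\mathrm{Pos}(\partial_kB)\to\mathrm{Pos}(B)$ are: $\sigma_0^B,\tau_0^B$ pick the first and last chosen $0$-cell, and $\sigma_{k+1}^{\mathrm{br}[B_1,\dots,B_n]}=\Sigma\sigma_k^{B_1}\vee\dots\vee\Sigma\sigma_k^{B_n}$, similarly for $\tau$. Let $D_0=\mathrm{br}[\,]$, $D_{n+1}=\mathrm{br}[D_n]$, so $\mathrm{Pos}(D_n)\cong\mathbb D^n$ with top cell $d_n$; let $Q_1=\mathrm{br}[D_0,D_0]$, $Q_{n+1}=\mathrm{br}[Q_n]$, so $\mathrm{Pos}(Q_n)$ consists of two $n$-cells $p_n,q_n$ with $t_{n-1}p_n=s_{n-1}q_n$ and represents pairs of $n$-cells composable along an $(n-1)$-cell. COMPUTADS WITH INVERTIBLE GENERATORS. By recursion on $n$ one defines: a category $\mathrm{iComp}_n$ with truncation functors; functors $\mathrm{Cell}_n\colon\mathrm{iComp}_n\to\mathrm{gSet}_n$ and $\mathrm{Cptd}_n\colon\mathrm{gSet}_n\to\mathrm{iComp}_n$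 with an adjunction $\mathrm{Cptd}_n\dashv\mathrm{Cell}_n$, compatible with truncation; for each tree $B$ a set $\mathrm{Full}_n(B)\subseteq\mathrm{Par}_n(\mathrm{Cell}_n\mathrm{Cptd}_n(\mathrm{tr}_n\mathrm{Pos}(B)))$ of full spheres; a functor $I_n\colon\mathrm{iComp}_n\to\mathrm{Set}$ (invertibility set); and natural functions $\mathrm{fwd}_n,\mathrm{linv}_n,\mathrm{rinv}_n\colon I_n(C)\to\mathrm{Cell}_n(C)_n$. Base: $\mathrm{iComp}_{-1}$ is terminal; $\mathrm{iComp}_0=\mathrm{Set}$, $\mathrm{Cell}_0$ and $\mathrm{Cptd}_0$ are identities, $\mathrm{gen}_0$ is the identity (a $0$-computad is its set $V_0$ of generators), $\mathrm{Full}_0(B)=\{(\sigma_0^B,\tau_0^B)\}$, $I_0(C)=\emptyset$. Successor: an $(n+1)$-computad is a tuple $C=(C_n,V_{n+1}^C,U_{n+1}^C,\phi_{n+1}^C,\psi_{n+1}^C)$ with $C_n\in\mathrm{iComp}_n$ (its truncation), sets $V_{n+1}^C$ (ordinary generators) and $U_{n+1}^C$ (invertible generators), and attaching functions $\phi_{n+1}^C\colon V_{n+1}^C\to\mathrm{Par}_n(\mathrm{Cell}_n(C_n))$, $\psi_{n+1}^C\colon U_{n+1}^C\to\mathrm{Par}_n(\mathrm{Cell}_n(C_n))$. The set $I_{n+1}(C)$ is the disjoint union of elements $\mathrm{igen}(u)$ ($u\in U_{n+1}^C$), $\mathrm{lunit}(i)$ and $\mathrm{runit}(i)$ ($i\in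 I_n(C_n)$). The function $\mathrm{ibdry}\colon I_{n+1}(C)\to\mathrm{Par}_n(\mathrm{Cell}_n(C_n))$ is $\mathrm{ibdry}(\mathrm{igen}(u))=\psi_{n+1}^C(u)$, $\mathrm{ibdry}(\mathrm{lunit}(i))=(\mathrm{linv}_n(i)*\mathrm{fwd}_n(i),\ \mathrm{id}_n(t_{n-1}\mathrm{fwd}_n(i)))$, $\mathrm{ibdry}(\mathrm{runit}(i))=(\mathrm{fwd}_n(i)*\mathrm{rinv}_n(i),\ \mathrm{id}_n(s_{n-1}\mathrm{fwd}_n(i)))$, with $*$ and $\mathrm{id}$ defined below. For $X\in\mathrm{gSet}_{n+1}$, $\mathrm{Cptd}_{n+1}(X)$ has truncation $\mathrm{Cptd}_n(\mathrm{tr}_nX)$, $V_{n+1}=X_{n+1}$, $U_{n+1}=\emptyset$, and $\phi_{n+1}(x)$ is the image of $(s_nx,t_nx)$ under the unit $\mathrm{tr}_nX\to\mathrm{Cell}_n\mathrm{Cptd}_n(\mathrm{tr}_nX)$. $\mathrm{Cell}_{n+1}(C)$ agrees with $\mathrm{Cell}_n(C_n)$ in dimensions $\le n$. Its set of $(n+1)$-cells with boundary function $\mathrm{bdry}=(s_n,t_n)$, and morphisms of $(n+1)$-computads into $C$, are defined mutually inductively (induction-recursion). The $(n+1)$-cells are freely: $\mathrm{gen}(v)$ for $v\in V_{n+1}^C$, with boundary $\phi_{n+1}^C(v)$; for each $i\in I_{n+1}(C)$, $\mathrm{fwd}_{n+1}(i)$ with boundary $\mathrm{ibdry}(i)$,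 and $\mathrm{linv}_{n+1}(i)$, $\mathrm{rinv}_{n+1}(i)$ with boundary $\mathrm{ibdry}(i)^{\mathrm{op}}$; and $\mathrm{coh}_{B,A}[f]$ for every tree $B$ with $\dim B\le n+1$, $A\in\mathrm{Full}_n(B)$ and morphism $f\colon\mathrm{Cptd}_{n+1}(\mathrm{Pos}(B))\to C$, with boundary $\mathrm{Par}_n(\mathrm{Cell}_n(f_n))(A)$. A morphism $f\colon D\to C$ is a triple of a morphism $f_n\colon D_n\to C_n$ and functions $f_V\colon V_{n+1}^D\to\mathrm{Cell}_{n+1}(C)_{n+1}$, $f_U\colon U_{n+1}^D\to I_{n+1}(C)$ with $\mathrm{bdry}\circ f_V=\mathrm{Par}_n(\mathrm{Cell}_n(f_n))\circ\phi_{n+1}^D$ and $\mathrm{ibdry}\circ f_U=\mathrm{Par}_n(\mathrm{Cell}_n(f_n))\circ\psi_{n+1}^D$. Action of $f$: $I_{n+1}(f)$ sends $\mathrm{igen}(u)\mapsto f_U(u)$, $\mathrm{lunit}(i)\mapsto\mathrm{lunit}(I_n(f_n)(i))$, $\mathrm{runit}(i)\mapsto\mathrm{runit}(I_n(f_n)(i))$; $\mathrm{Cell}_{n+1}(f)$ is $\mathrm{Cell}_n(f_n)$ below dimension $n+1$ and sends $\mathrm{gen}(v)\mapsto f_V(v)$, $\mathrm{fwd}(i)\mapsto\mathrm{fwd}(I_{n+1}(f)(i))$ and likewise for $\mathrm{linv},\mathrm{rinv}$, $\mathrm{coh}_{B,A}[g]\mapsto\mathrm{coh}_{B,A}[f\circ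 g]$. Composition: $(f\circ g)_n=f_n\circ g_n$, $(f\circ g)_V=\mathrm{Cell}_{n+1}(f)\circ g_V$, $(f\circ g)_U=I_{n+1}(f)\circ g_U$; identity $(\mathrm{id},\mathrm{gen},\mathrm{igen})$. For $h\colon X\to Y$ in $\mathrm{gSet}_{n+1}$, $\mathrm{Cptd}_{n+1}(h)=(\mathrm{Cptd}_n(\mathrm{tr}_nh),\mathrm{gen}\circ h_{n+1},!)$. The unit of $\mathrm{Cptd}_{n+1}\dashv\mathrm{Cell}_{n+1}$ sends cells to the corresponding generators; the counit $\mathrm{Cptd}_{n+1}\mathrm{Cell}_{n+1}(C)\to C$ sends each generator to the cell it is. Support of an $(n+1)$-cell (a set of $(n+1)$-dimensional generators): $\mathrm{supp}(\mathrm{gen}(v))=\{v\}$; $\mathrm{supp}$ of $\mathrm{fwd}(i),\mathrm{linv}(i),\mathrm{rinv}(i)$ is $\{u\}$ if $i=\mathrm{igen}(u)$ and $\emptyset$ otherwise; $\mathrm{supp}(\mathrm{coh}_{B,A}[f])=\bigcup_{p\in\mathrm{Pos}(B)_{n+1}}\mathrm{supp}(f_V(p))$. A pair $(a,b)\in\mathrm{Par}_{n+1}(\mathrm{Cell}_{n+1}\mathrm{Cptd}_{n+1}(\mathrm{tr}_{n+1}\mathrm{Pos}(B)))$ is in $\mathrm{Full}_{n+1}(B)$ iff $\mathrm{supp}(a)$ and $\mathrm{supp}(b)$ are the images of $\mathrm{Pos}(\partial_{n+1}B)_{n+1}$ under $\sigma_{n+1}^B$ and $\tau_{n+1}^B$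 respectively, and $\mathrm{bdry}(a)=\mathrm{bdry}(b)\in\mathrm{Full}_n(B)$. Identities and composites: for an $n$-cell $c$ of $C$, $\mathrm{id}_{n+1}(c)=\mathrm{coh}_{D_n,(\mathrm{gen}(d_n),\mathrm{gen}(d_n))}[\hat c]$, where $\hat c\colon\mathrm{Cptd}_{n+1}(\mathrm{Pos}(D_n))\to C$ corresponds to $c$; for $(n+1)$-cells $a,b$ with $t_na=s_nb$, $a*b=\mathrm{coh}_{Q_{n+1},(\mathrm{gen}(s_np_{n+1}),\mathrm{gen}(t_nq_{n+1}))}[\widehat{(a,b)}]$, where $\widehat{(a,b)}\colon\mathrm{Cptd}_{n+1}(\mathrm{Pos}(Q_{n+1}))\to C$ sends $p_{n+1}\mapsto a$, $q_{n+1}\mapsto b$. Limit: $\mathrm{iComp}=\mathrm{iComp}_\omega=\lim_n\mathrm{iComp}_n$ along truncations, so a computad $C$ is a compatible sequence $(C_n)_n$, and $\mathrm{Cptd}\dashv\mathrm{Cell}$ between $\mathrm{gSet}$ and $\mathrm{iComp}$ is induced levelwise. $\mathrm{Comp}\subseteq\mathrm{iComp}$ is the full subcategory of ordinary computads: those with $U_m=\emptyset$ for all $m\geq 1$. The inclusion $\mathrm{Comp}\hookrightarrow\mathrm{iComp}$ has a right adjoint, denoted $R$. WEAK $\omega$-CATEGORIES. $T=\mathrm{Cell}\circ\mathrm{Cptd}$ is the monad on $\mathrm{gSet}$ induced by $\mathrm{Cptd}\dashv\mathrm{Cell}$ and $\mathrm{Cat}_\omega$ is its category of algebras (weak $\omega$-categories).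 $K\colon\mathrm{iComp}\to\mathrm{Cat}_\omega$ is the comparison functor, $K(C)=(\mathrm{Cell}(C),\mathrm{Cell}(\varepsilon_C))$ with $\varepsilon$ the counit; $K(C)$ is the weak $\omega$-category generated by $C$. *)

(* Defs.v *)
From Stdlib Require Import ssreflect List Arith.
From Stdlib Require Import FunctionalExtensionality ProofIrrelevance.

Set Implicit Arguments.
Unset Strict Implicit.
Unset Printing Implicit Defensive.
Set Primitive Projections.

Record Category := {
  Ob :> Type;
  Hom : Ob -> Ob -> Type;
  idm : forall X, Hom X X;
  compm : forall X Y Z, Hom Y Z -> Hom X Y -> Hom X Z;
  compmA : forall W X Y Z (h : Hom Y Z) (g : Hom X Y) (f : Hom W X),
    compm h (compm g f) = compm (compm h g) f;
  compm1 : forall X Y (f : Hom X Y), compm f (idm X) = f;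
  comp1m : forall X Y (f : Hom X Y), compm (idm Y) f = f
}.
Arguments Hom {c} X Y.
Arguments idm {c} X.
Arguments compm {c X Y Z} g f.
Notation "g ∘ f" := (compm g f) (at level 40, left associativity).

Record Functor (A B : Category) := {
  fob :> A -> B;
  fmap : forall X Y : A, Hom X Y -> Hom (fob X) (fob Y);
  fmap1 : forall X, fmap (idm X) = idm (fob X);
  fmapM : forall X Y Z (g : Hom Y Z) (f : Hom X Y), fmap (g ∘ f) = fmap g ∘ fmap f
}.
Arguments fmap {A B} F {X Y} f : rename.

Definition isomorphic (A : Category) (X Y : A) : Prop :=
  exists (f : Hom X Y) (g : Hom Y X), g ∘ f = idm X /\ f ∘ g = idm Y.

Definition SET : Category.
refine {| Ob := Type; Hom := fun X Y => X -> Y;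
          idm := fun X x => x; compm := fun X Y Z g f x => g (f x) |}; by [].
Defined.

Record Adjunction (A B : Category) (F : Functor A B) (G : Functor B A) := {
  unit_ : forall X : A, Hom X (G (F X));
  counit : forall Y : B, Hom (F (G Y)) Y;
  unitN : forall (X X' : A) (f : Hom X X'), unit_ X' ∘ f = fmap G (fmap F f) ∘ unit_ X;
  counitN : forall (Y Y' : B) (f : Hom Y Y'), counit Y' ∘ fmap F (fmap G f) = f ∘ counit Y;
  triangleF : forall X : A, counit (F X) ∘ fmap F (unit_ X) = idm (F X);
  triangleG : forall Y : B, fmap G (counit Y) ∘ unit_ (G Y) = idm (G Y)
}.
Arguments unit_ {A B F G} a X.
Arguments counit {A B F G} a Y.

Record Monad (A : Category) := {
  mfun :> Functor A A;
  eta : forall X : A, Hom X (mfun X);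
  mu : forall X : A, Hom (mfun (mfun X)) (mfun X);
  etaN : forall (X Y : A) (f : Hom X Y), eta Y ∘ f = fmap mfun f ∘ eta X;
  muN : forall (X Y : A) (f : Hom X Y), mu Y ∘ fmap mfun (fmap mfun f) = fmap mfun f ∘ mu X;
  mu_eta : forall X, mu X ∘ eta (mfun X) = idm (mfun X);
  mu_fmap_eta : forall X, mu X ∘ fmap mfun (eta X) = idm (mfun X);
  muA : forall X, mu X ∘ mu (mfun X) = mu X ∘ fmap mfun (mu X)
}.
Arguments eta {A} m X.
Arguments mu {A} m X.

Record Algebra (A : Category) (T : Monad A) := {
  carrier : A;
  action : Hom (T carrier) carrier;
  action_eta : action ∘ eta T carrier = idm carrier;
  action_mu : action ∘ mu T carrier = action ∘ fmap T action
}.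

Record AlgebraHom (A : Category) (T : Monad A) (X Y : Algebra T) := {
  ahom : Hom (carrier X) (carrier Y);
  ahomE : ahom ∘ action X = action Y ∘ fmap T ahom
}.

Lemma AlgebraHom_ext (A : Category) (T : Monad A) (X Y : Algebra T) (f g : AlgebraHom X Y) :
  ahom f = ahom g -> f = g.
Proof.
  case: f => f pf; case: g => g pg /= e; subst g; by rewrite (proof_irrelevance _ pf pg).
Qed.

Definition algebras (A : Category) (T : Monad A) : Category.
refine {| Ob := Algebra T; Hom := @AlgebraHom A T |}.
Unshelve.
all: cycle 3.
- move=> X; exists (idm _); by rewrite fmap1 compm1 comp1m.
- move=> X Y Z g f; exists (ahom g ∘ ahom f).
  by rewrite fmapM -compmA ahomE compmA ahomE -!compmA.
- move=> *; apply: AlgebraHom_ext; exact: compmA.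
- move=> *; apply: AlgebraHom_ext; exact: compm1.
- move=> *; apply: AlgebraHom_ext; exact: comp1m.
Defined.

Definition fcomp (A B C : Category) (G : Functor B C) (F : Functor A B) : Functor A C.
refine {| fob := fun X => G (F X); fmap := fun X Y f => fmap G (fmap F f) |}.
- move=> X; by rewrite !fmap1.
- move=> *; by rewrite !fmapM.
Defined.

Section Comparison.
Context (A B : Category) (F : Functor A B) (G : Functor B A) (adj : Adjunction F G).

Definition adj_monad : Monad A.
refine {| mfun := fcomp G F; eta := unit_ adj; mu := fun X => fmap G (counit adj (F X)) |}.
- exact: unitN.
- move=> X Y f /=; by rewrite -!fmapM counitN.
- move=> X /=; exact: triangleG.
- move=> X /=; by rewrite -fmapM triangleF fmap1.
- move=> X /=; by rewrite -!fmapM counitN.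
Defined.

Definition comparison_ob (Y : B) : Algebra adj_monad.
refine {| carrier := G Y; action := fmap G (counit adj Y) : Hom (adj_monad (G Y)) (G Y) |}.
- rewrite /=; exact: triangleG.
- by rewrite /= -!fmapM counitN.
Defined.

Definition comparison_hom (X Y : B) (f : Hom X Y) :
  AlgebraHom (comparison_ob X) (comparison_ob Y).
exists (fmap G f); by rewrite /= -!fmapM counitN.
Defined.

Definition comparison : Functor B (algebras adj_monad).
refine {| fob := comparison_ob : B -> algebras adj_monad; fmap := comparison_hom |}.
- move=> X; apply: AlgebraHom_ext; exact: fmap1.
- move=> X Y Z g f; apply: AlgebraHom_ext; exact: fmapM.
Defined.

End Comparison.

Definition full_subcategory (A : Category) (P : A -> Prop) : Category.
refine {| Ob := {X : A | P X}; Hom := fun X Y => Hom (proj1_sig X) (proj1_sig Y);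
          idm := fun X => idm (proj1_sig X);
          compm := fun X Y Z g f => g ∘ f |}.
- move=> *; exact: compmA.
- move=> *; exact: compm1.
- move=> *; exact: comp1m.
Defined.

Definition inclusion (A : Category) (P : A -> Prop) : Functor (full_subcategory P) A.
by refine {| fob := (fun X => proj1_sig X) : full_subcategory P -> A;
             fmap := fun X Y f => f |}.
Defined.

(* A category of truncated globular sets, with the functor sending an object to its
   pairs of parallel cells of top dimension. *)
Record ParCategory := { pcat :> Category; Par : Functor pcat SET }.
Arguments Par {p}.

Section Extension.
Context (P : ParCategory).

Record ext := { base : P; top : Type; bdry : top -> Par base }.

Record ext_hom (X Y : ext) := {
  hbase : Hom (base X) (base Y);
  htop : top X -> top Y;
  hbdry : forall x, bdry (htop x) = fmap Par hbase (bdry x)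
}.

Record par (X : ext) := { src : top X; tgt : top X; parE : bdry src = bdry tgt }.

Lemma ext_hom_ext X Y (f g : ext_hom X Y) :
  hbase f = hbase g -> (forall x, htop f x = htop g x) -> f = g.
Proof.
  case: f => f f' pf; case: g => g g' pg /= e /functional_extensionality e'; subst g g'.
  by rewrite (proof_irrelevance _ pf pg).
Qed.

Lemma par_ext X (p q : par X) : src p = src q -> tgt p = tgt q -> p = q.
Proof.
  case: p => a b p; case: q => a' b' q /= ea eb; subst a' b'.
  by rewrite (proof_irrelevance _ p q).
Qed.

Definition ext_cat : Category.
refine {| Ob := ext; Hom := ext_hom |}.
Unshelve.
all: cycle 3.
- move=> X; exists (idm _) (fun x => x); by rewrite fmap1.
- move=> X Y Z g f; exists (hbase g ∘ hbase f) (fun x => htop g (htop f x)).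
  by move=> x; rewrite fmapM !hbdry.
- move=> *; apply: ext_hom_ext => //=; exact: compmA.
- move=> *; apply: ext_hom_ext => //=; exact: compm1.
- move=> *; apply: ext_hom_ext => //=; exact: comp1m.
Defined.

Definition par_map X Y (f : ext_hom X Y) (p : par X) : par Y.
exists (htop f (src p)) (htop f (tgt p)); by rewrite !hbdry parE.
Defined.

Definition par_fun : Functor ext_cat SET.
refine {| fob := (fun X => par X) : ext_cat -> SET; fmap := par_map |}.
- by move=> X; apply: functional_extensionality => p; apply: par_ext.
- by move=> X Y Z g f; apply: functional_extensionality => p; apply: par_ext.
Defined.

Definition par_op (X : ext) (p : par X) : par X :=
  {| src := tgt p; tgt := src p; parE := eq_sym (parE p) |}.

Definition ext_par : ParCategory := {| pcat := ext_cat; Par := par_fun |}.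
End Extension.

Definition terminal_cat : Category.
by refine {| Ob := unit; Hom := fun _ _ => unit;
             idm := fun _ => tt; compm := fun _ _ _ _ _ => tt |} => //; move=> ? ? [].
Defined.

Definition terminal_par : ParCategory.
by refine {| pcat := terminal_cat;
             Par := {| fob := (fun _ => unit) : terminal_cat -> SET;
                       fmap := fun _ _ _ x => x |} |}.
Defined.

(* [glob m] is the category of (m-1)-globular sets, starting at dimension -1: an
   n-globular set is presented as an (n-1)-globular set with a set of n-cells and a
   map x |-> (s x, t x) to the parallel pairs of (n-1)-cells.  This makes the
   truncation of an extended object definitionally equal to its base. *)
Fixpoint glob (m : nat) : ParCategory :=
  match m with 0 => terminal_par | S m => ext_par (glob m) end.

Notation gSet_ n := (glob (S n)).

Record gset := {
  cell :> nat -> Type;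
  gs : forall k, cell (S k) -> cell k;
  gt : forall k, cell (S k) -> cell k;
  gs_gs : forall k (x : cell (S (S k))), gs (gs x) = gs (gt x);
  gt_gs : forall k (x : cell (S (S k))), gt (gs x) = gt (gt x)
}.

Record gset_hom (X Y : gset) := {
  gfun :> forall k, X k -> Y k;
  gfun_s : forall k (x : X (S k)), gfun (gs x) = gs (gfun x);
  gfun_t : forall k (x : X (S k)), gfun (gt x) = gt (gfun x)
}.

Lemma gset_hom_ext X Y (f g : gset_hom X Y) : (forall k (x : X k), f k x = g k x) -> f = g.
Proof.
  case: f => f sf tf; case: g => g sg tg /= e.
  have {}e : f = g by do 2 apply: functional_extensionality_dep => ?; exact: e.
  subst g; by rewrite (proof_irrelevance _ sf sg) (proof_irrelevance _ tf tg).
Qed.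

Definition gSet : Category.
refine {| Ob := gset; Hom := gset_hom |}.
Unshelve.
all: cycle 3.
- by move=> X; exists (fun k x => x).
- move=> X Y Z g f; exists (fun k x => g k (f k x)) => k x;
    by rewrite ?gfun_s ?gfun_t.
- by move=> *; apply: gset_hom_ext.
- by move=> *; apply: gset_hom_ext.
- by move=> *; apply: gset_hom_ext.
Defined.

Record trunc_data (X : gset) (m : nat) := {
  td_ob : glob m;
  td_bdry : X m -> Par td_ob;
  td_bdryE : forall x : X (S m), td_bdry (gs x) = td_bdry (gt x)
}.

Definition trunc_ext (X : gset) (m : nat) (d : trunc_data X m) : ext (glob m) :=
  {| base := td_ob d; top := X m; bdry := @td_bdry _ _ d |}.

Definition trunc_step (X : gset) (m : nat) (d : trunc_data X m) : trunc_data X (S m).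
refine {| td_ob := trunc_ext d : glob (S m);
          td_bdry := fun x : X (S m) =>
            {| src := gs x : top (trunc_ext d); tgt := gt x : top (trunc_ext d);
               parE := td_bdryE d x |} |}.
move=> x; apply: par_ext; [exact: gs_gs | exact: gt_gs].
Defined.

Fixpoint trunc_rec (X : gset) (m : nat) : trunc_data X m :=
  match m with
  | 0 => {| td_ob := tt : glob 0; td_bdry := fun _ => tt; td_bdryE := fun _ => eq_refl |}
  | S m => trunc_step (trunc_rec X m)
  end.

Definition trunc_ob m (X : gset) : glob m := td_ob (trunc_rec X m).
Definition trunc_bdry m (X : gset) : X m -> Par (trunc_ob m X) := @td_bdry _ _ (trunc_rec X m).

Definition trunc_bdryE m (X : gset) (x : X (S m)) : trunc_bdry (gs x) = trunc_bdry (gt x) :=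
  td_bdryE (trunc_rec X m) x.

Definition trunc_hom_data (X Y : gset) (f : gset_hom X Y) (m : nat) : Type :=
  {h : Hom (trunc_ob m X) (trunc_ob m Y) |
   forall x : X m, fmap Par h (trunc_bdry x) = trunc_bdry (f m x)}.

Definition trunc_hom_step (X Y : gset) (f : gset_hom X Y) (m : nat)
  (d : trunc_hom_data f m) : trunc_hom_data f (S m).
exists (@Build_ext_hom (glob m) (trunc_ext (trunc_rec X m)) (trunc_ext (trunc_rec Y m))
          (proj1_sig d) (f m) (fun x => eq_sym (proj2_sig d x))).
move=> x; apply: par_ext; [exact: gfun_s | exact: gfun_t].
Defined.

Fixpoint trunc_hom_rec (X Y : gset) (f : gset_hom X Y) (m : nat) : trunc_hom_data f m :=
  match m with
  | 0 => exist _ (tt : @Hom (glob 0) _ _) (fun _ => eq_refl)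
  | S m => trunc_hom_step (trunc_hom_rec f m)
  end.

Definition trunc (m : nat) : Functor gSet (glob m).
refine {| fob := trunc_ob m : gSet -> glob m;
          fmap := fun X Y f => proj1_sig (trunc_hom_rec f m) |}.
- move=> X; elim: m => [|m IH] //; exact: ext_hom_ext.
- move=> X Y Z g f; elim: m => [|m IH] //; exact: ext_hom_ext.
Defined.

Inductive tree : Type := br (Bs : list tree).

Fixpoint dim (B : tree) : nat :=
  match B with br Bs => list_max (map (fun B => S (dim B)) Bs) end.

Fixpoint tbdry (k : nat) (B : tree) : tree :=
  match k, B with
  | 0, _ => br nil
  | S k, br Bs => br (map (tbdry k) Bs)
  end.

Record pgset := { pcell :> gset; first : pcell 0; last : pcell 0 }.

Definition point : pgset.
by refine {| pcell := {| cell := fun k => match k with 0 => unit | S _ => Empty_set end;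
                         gs := fun k (x : Empty_set) => match x with end;
                         gt := fun k (x : Empty_set) => match x with end |};
             first := tt; last := tt |}.
Defined.

(* [susp_wedge X Y] is the wedge of the suspension of [X] with [Y]: the chosen
   0-cell tau of the suspension is identified with [first Y], and sigma is [None]. *)
Section SuspWedge.
Context (X : gset) (Y : pgset).

Definition sw_cell (k : nat) : Type :=
  match k with 0 => option (Y 0) | S k => X k + Y (S k) end.

Definition sw_s (k : nat) : sw_cell (S k) -> sw_cell k :=
  match k with
  | 0 => fun x => match x with inl _ => None | inr y => Some (gs y) end
  | S k => fun x => match x with inl x => inl (gs x) | inr y => inr (gs y) end
  end.

Definition sw_t (k : nat) : sw_cell (S k) -> sw_cell k :=
  match k with
  | 0 => fun x => match x with inl _ => Some (first Y) | inr y => Some (gt y) end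
  | S k => fun x => match x with inl x => inl (gt x) | inr y => inr (gt y) end
  end.

Definition susp_wedge : pgset.
refine {| pcell := {| cell := sw_cell; gs := sw_s; gt := sw_t |};
          first := None; last := Some (last Y) |}.
- by case=> [|k] [x|y] //=; rewrite gs_gs.
- by case=> [|k] [x|y] //=; rewrite gt_gs.
Defined.
End SuspWedge.

(* An iterated wedge is built from the right, starting from the empty wedge [point]. *)
Fixpoint Pos (B : tree) : pgset :=
  match B with br Bs => fold_right (fun B Y => susp_wedge (Pos B) Y) point Bs end.

Record pgset_hom (X Y : pgset) := {
  pfun :> gset_hom X Y;
  pfun_first : pfun 0 (first X) = first Y;
  pfun_last : pfun 0 (last X) = last Y
}.

Definition pgset_id (X : pgset) : pgset_hom X X.
by exists (idm (X : gSet)).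
Defined.

Section SuspWedgeMap.
Context (X X' : gset) (Y Y' : pgset) (f : gset_hom X X') (g : pgset_hom Y Y').

Definition sw_map (k : nat) : susp_wedge X Y k -> susp_wedge X' Y' k :=
  match k with
  | 0 => fun x => match x with None => None | Some y => Some (g 0 y) end
  | S k => fun x => match x with inl x => inl (f k x) | inr y => inr (g (S k) y) end
  end.

Definition susp_wedge_map : pgset_hom (susp_wedge X Y) (susp_wedge X' Y').
unshelve eexists.
- exists sw_map.
  + by case=> [|k] [x|y] //=; rewrite gfun_s.
  + by case=> [|k] [x|y] //=; rewrite ?gfun_t ?pfun_first.
- by [].
- by rewrite /= pfun_last.
Defined.
End SuspWedgeMap.

Definition pick (X : pgset) (x : X 0) : gset_hom point X.
by exists (fun k => match k return point k -> X k with
                    | 0 => fun _ => x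
                    | S k => fun e => match e : Empty_set with end end).
Defined.

Fixpoint wedge_map (h : tree -> tree) (f : forall B, gset_hom (Pos (h B)) (Pos B))
    (Bs : list tree) : pgset_hom (Pos (br (map h Bs))) (Pos (br Bs)) :=
  match Bs with
  | nil => pgset_id point
  | B :: Bs => susp_wedge_map (f B) (wedge_map f Bs)
  end.

Section PosMaps.
Context (e : forall B, Pos B 0).

Fixpoint pos_map (k : nat) (B : tree) : gset_hom (Pos (tbdry k B)) (Pos B) :=
  match k return gset_hom (Pos (tbdry k B)) (Pos B) with
  | 0 => pick (e B)
  | S k =>
    match B return gset_hom (Pos (tbdry (S k) B)) (Pos B) with
    | br Bs => wedge_map (pos_map k) Bs
    end
  end.
End PosMaps.

Definition pos_src := pos_map (fun B => first (Pos B)).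
Definition pos_tgt := pos_map (fun B => last (Pos B)).

Fixpoint susp_tree (n : nat) (B : tree) : tree :=
  match n with 0 => B | S n => br (susp_tree n B :: nil) end.

Definition Dtree (n : nat) : tree := susp_tree n (br nil).

(* Index shift: [Qtree n] is the tree Q_(n+1). *)
Definition Qtree (n : nat) : tree := susp_tree n (br (br nil :: br nil :: nil)).

Fixpoint d_top (n : nat) : Pos (Dtree n) n :=
  match n with 0 => tt | S n => inl (d_top n) end.

Fixpoint p_top (n : nat) : Pos (Qtree n) (S n) :=
  match n with 0 => inl tt | S n => inl (p_top n) end.

Fixpoint q_top (n : nat) : Pos (Qtree n) (S n) :=
  match n with 0 => inr (inl tt) | S n => inl (q_top n) end.

Lemma gt_p_top n : gt (p_top n) = gs (q_top n).
Proof. by elim: n => [|n IH] //=; rewrite IH. Qed.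

Lemma dim_Dtree n : dim (Dtree n) = n.
Proof. elim: n => [|n IH] //; by rewrite /= -/(Dtree n) IH. Qed.

Lemma dim_Qtree n : dim (Qtree n) = S n.
Proof. elim: n => [|n IH] //; by rewrite /= -/(Qtree n) IH. Qed.

Lemma Dtree_above n : Pos (Dtree n) (S n) -> False.
Proof. by elim: n => [|n IH] [] //. Qed.

(* The positions of [Qtree n] in dimensions [n] and [S n]: three [n]-cells,
   numbered from the source of [p_top n] to the target of [q_top n], and the
   two cells [p_top n] and [q_top n]. *)
Inductive three := t0 | t1 | t2.

Fixpoint Q_obj (n : nat) : Pos (Qtree n) n -> three :=
  match n return Pos (Qtree n) n -> three with
  | 0 => fun x => match x with None => t0 | Some None => t1 | Some (Some _) => t2 end
  | S n => fun x => match x with inl x => @Q_obj n x | inr e => match e : Empty_set with end end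
  end.

Fixpoint Q_arr (n : nat) : Pos (Qtree n) (S n) -> bool :=
  match n return Pos (Qtree n) (S n) -> bool with
  | 0 => fun x => match x with inl _ => true | inr _ => false end
  | S n => fun x => match x with inl x => @Q_arr n x | inr _ => false end
  end.

Lemma Q_obj_s n (x : Pos (Qtree n) (S n)) : @Q_obj n (gs x) = if @Q_arr n x then t0 else t1.
Proof. elim: n x => [|n IH] [] //; by case. Qed.

Lemma Q_obj_t n (x : Pos (Qtree n) (S n)) : @Q_obj n (gt x) = if @Q_arr n x then t1 else t2.
Proof. elim: n x => [|n IH] [] //; by case=> [[]|[]]. Qed.

(* Below dimension [n] the positions of [susp_tree n B] form a sphere: two cells
   in each dimension, [true] marking sources and [false] targets. *)
Fixpoint side (n : nat) (B : tree) : forall k, Pos (susp_tree n B) k -> bool :=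
  match n return forall k, Pos (susp_tree n B) k -> bool with
  | 0 => fun _ _ => true
  | S n => fun k =>
    match k return Pos (susp_tree (S n) B) k -> bool with
    | 0 => fun x => match x with None => true | Some _ => false end
    | S k => fun x => match x with inl x => @side n B k x | inr _ => true end
    end
  end.

Lemma side_s n B k (x : Pos (susp_tree n B) (S k)) : k < n -> @side n B k (gs x) = true.
Proof.
  elim: n k x => [|n IH] k x; first by move/Nat.nlt_0_r.
  case: k x => [|k] [x|[]] //= lt_kn; by apply: IH; apply/Nat.succ_lt_mono.
Qed.

Lemma side_t n B k (x : Pos (susp_tree n B) (S k)) : k < n -> @side n B k (gt x) = false.
Proof.
  elim: n k x => [|n IH] k x; first by move/Nat.nlt_0_r.
  case: k x => [|k] [x|[]] //= lt_kn; by apply: IH; apply/Nat.succ_lt_mono.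
Qed.

Section SphereMap.
Context (N : nat) (B : tree).
Notation P := (Pos (susp_tree N B)).

Definition sphere_data (m : nat) (X : glob m) (p : Par X) : Type :=
  {h : Hom (trunc_ob m P) X | forall x : P m, fmap Par h (trunc_bdry x) = p}.

Definition sphere_step (m : nat) (lt_mN : m < N) (X : ext (glob m)) (p : par X)
  (d : sphere_data (bdry (src p))) : @sphere_data (S m) X p.
unshelve eexists.
- exists (proj1_sig d) (fun x : P m => if @side N B m x then src p else tgt p).
  move=> x; rewrite (proj2_sig d); by case: (side x); rewrite -?parE.
- by move=> x; apply: par_ext; rewrite /= ?side_s ?side_t.
Defined.

Fixpoint sphere_rec (m : nat) : m <= N -> forall (X : glob m) (p : Par X), sphere_data p :=
  match m return m <= N -> forall (X : glob m) (p : Par X), sphere_data p with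
  | 0 => fun _ X => match X with tt => fun p => match p with tt =>
           exist _ (tt : @Hom (glob 0) tt tt) (fun _ => eq_refl) end end
  | S m => fun lt_mN X p =>
      @sphere_step m lt_mN X p (@sphere_rec m (Nat.lt_le_incl _ _ lt_mN) _ _)
  end.

Definition sphere_map (X : glob N) (p : Par X) : Hom (trunc_ob N P) X :=
  proj1_sig (sphere_rec (le_n N) p).

Lemma sphere_mapE (X : glob N) (p : Par X) (x : P N) :
  fmap Par (sphere_map p) (trunc_bdry x) = p.
Proof. exact: (proj2_sig (sphere_rec (le_n N) p)). Qed.

Lemma sphere_rec_nat m (le_mN : m <= N) (X Y : glob m) (f : Hom X Y) (p : Par X) :
  f ∘ proj1_sig (sphere_rec le_mN p) = proj1_sig (sphere_rec le_mN (fmap Par f p)).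
Proof.
  elim: m le_mN X Y f p => [|m IH] lt_mN X Y f p; first by case: X Y f p => [] [] [] [].
  apply: ext_hom_ext => [|x] /=.
  - by rewrite IH hbdry.
  - by case: (side x).
Qed.

Lemma sphere_map_nat (X Y : glob N) (f : Hom X Y) (p : Par X) :
  f ∘ sphere_map p = sphere_map (fmap Par f p).
Proof. exact: sphere_rec_nat. Qed.

End SphereMap.
Arguments sphere_map N B {X} p.

(* [Dtree n] has a single [n]-position, so no case distinction is needed to send
   it to [c]. *)
Definition disk_map (n : nat) (X : gSet_ n) (c : top X) : Hom (trunc_ob (S n) (Pos (Dtree n))) X.
exists (sphere_map n (br nil) (bdry c)) (fun _ => c).
move=> x; by rewrite sphere_mapE.
Defined.

Lemma disk_map_nat (n : nat) (X Y : gSet_ n) (f : Hom X Y) (c : top X) :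
  f ∘ disk_map c = disk_map (htop f c).
Proof. by apply: ext_hom_ext => //=; rewrite sphere_map_nat hbdry. Qed.

Section PairMap.
Context (n : nat) (X : gSet_ (S n)) (a b : top X) (ab : tgt (bdry a) = src (bdry b)).

Definition pair_map_obj (x : three) : top (base X) :=
  match x with t0 => src (bdry a) | t1 => tgt (bdry a) | t2 => tgt (bdry b) end.

Lemma pair_map_objE x : bdry (pair_map_obj x) = bdry (src (bdry a)).
Proof. case: x => //=; by rewrite ?ab -?parE ?ab -?parE -?ab ?parE. Qed.

Definition pair_map_base : Hom (trunc_ob (S n) (Pos (Qtree n))) (base X).
exists (sphere_map n _ (bdry (src (bdry a)))) (fun x : Pos (Qtree n) n => pair_map_obj (Q_obj x)).
move=> x; by rewrite pair_map_objE sphere_mapE.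
Defined.

Definition pair_map : Hom (trunc_ob (S (S n)) (Pos (Qtree n))) X.
exists pair_map_base (fun x : Pos (Qtree n) (S n) => if Q_arr x then a else b).
move=> x; apply: par_ext; rewrite /= ?Q_obj_s ?Q_obj_t; by case: (Q_arr x).
Defined.
End PairMap.

Lemma pair_map_nat (n : nat) (X Y : gSet_ (S n)) (f : Hom X Y) (a b : top X)
    (ab : tgt (bdry a) = src (bdry b)) (ab' : tgt (bdry (htop f a)) = src (bdry (htop f b))) :
  f ∘ pair_map ab = pair_map ab'.
Proof.
  apply: ext_hom_ext => [|x]; last by rewrite /=; case: (Q_arr x).
  apply: ext_hom_ext => [|x] /=; first by rewrite sphere_map_nat !hbdry.
  by rewrite /pair_map_obj !hbdry; case: (Q_obj x).
Qed.

(* Implies the fullness of the pair of generators [(a, b)]; used only to show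
   that the boundaries of identities and composites are full, in [Full_gen]. *)
Fixpoint pos_full (n : nat) (B : tree) : Pos B n -> Pos B n -> Prop :=
  match n return Pos B n -> Pos B n -> Prop with
  | 0 => fun a b => a = first (Pos B) /\ b = last (Pos B)
  | S n => fun a b =>
      (forall x, x = a <-> exists y, x = pos_src (S n) B (S n) y) /\
      (forall x, x = b <-> exists y, x = pos_tgt (S n) B (S n) y) /\
      @pos_full n B (gs a) (gt a)
  end.

Lemma pos_full_susp n B (a b : Pos B n) :
  pos_full a b -> @pos_full (S n) (br (B :: nil)) (inl a) (inl b).
Proof.
  elim: n B a b => [|n IH] B a b /=.
  - case=> -> ->; split; [|split] => // x; split.
    + by move=> ->; exists (inl tt).
    + by case=> -[y|[]] ->.
    + by move=> ->; exists (inl tt).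
    + by case=> -[y|[]] ->.
  - case=> Ha [Hb /IH {}IH]; split; [|split] => //.
    + move=> x; split.
      * move=> ->; case: (proj1 (Ha a) eq_refl) => y e; by exists (inl y); rewrite e.
      * case=> -[y|[]] -> /=; congr inl; apply/Ha; by exists y.
    + move=> x; split.
      * move=> ->; case: (proj1 (Hb b) eq_refl) => y e; by exists (inl y); rewrite e.
      * case=> -[y|[]] -> /=; congr inl; apply/Hb; by exists y.
Qed.

Lemma pos_full_d n : pos_full (d_top n) (d_top n).
Proof. elim: n => [|n IH] //; exact: pos_full_susp. Qed.

Lemma pos_full_pq n : pos_full (gs (p_top n)) (gt (q_top n)).
Proof. elim: n => [|n IH] //; exact: (pos_full_susp IH). Qed.

Lemma pq_par n : trunc_bdry (gs (p_top n)) = trunc_bdry (gt (q_top n)).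
Proof. by rewrite -trunc_bdryE -gt_p_top trunc_bdryE. Qed.

(* The data defined at stage [n] of the recursion.  The unit boundaries of an
   element [i] of the invertibility set are the pairs
     (linv i * fwd i, id (t (fwd i)))  and  (fwd i * rinv i, id (s (fwd i)))
   of parallel [n]-cells, which are the boundaries of [lunit i] and [runit i] at
   stage [n + 1]. *)
Record Stage (n : nat) := {
  iComp_ : Category;
  Cell_ : Functor iComp_ (gSet_ n);
  Cptd_ : Functor (gSet_ n) iComp_;
  adj_ : Adjunction Cptd_ Cell_;
  Full_ : forall B : tree, Par (Cell_ (Cptd_ (trunc_ob (S n) (Pos B)))) -> Prop;
  Inv_ : Functor iComp_ SET;
  fwd_ : forall C, Inv_ C -> top (Cell_ C);
  linv_ : forall C, Inv_ C -> top (Cell_ C);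
  rinv_ : forall C, Inv_ C -> top (Cell_ C);
  lunit_bdry : forall C, Inv_ C -> Par (Cell_ C);
  runit_bdry : forall C, Inv_ C -> Par (Cell_ C);
  lunit_bdryN : forall C D (f : Hom C D) (i : Inv_ C),
    lunit_bdry (fmap Inv_ f i) = fmap Par (fmap Cell_ f) (lunit_bdry i);
  runit_bdryN : forall C D (f : Hom C D) (i : Inv_ C),
    runit_bdry (fmap Inv_ f i) = fmap Par (fmap Cell_ f) (runit_bdry i);
  fwd_N : forall C D (f : Hom C D) (i : Inv_ C),
    fwd_ (fmap Inv_ f i) = htop (fmap Cell_ f) (fwd_ i);
  linv_N : forall C D (f : Hom C D) (i : Inv_ C),
    linv_ (fmap Inv_ f i) = htop (fmap Cell_ f) (linv_ i);
  rinv_N : forall C D (f : Hom C D) (i : Inv_ C),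
    rinv_ (fmap Inv_ f i) = htop (fmap Cell_ f) (rinv_ i);
  Full_gen : forall B (a b : Pos B n) (ab : trunc_bdry a = trunc_bdry b), pos_full a b ->
    @Full_ B (fmap Par (unit_ adj_ (trunc_ob (S n) (Pos B)))
                {| src := a : top (trunc_ob (S n) (Pos B)); tgt := b; parE := ab |})
}.

Section Stage0.

Definition set_glob0 (V : Type) : gSet_ 0 :=
  @Build_ext (glob 0) tt V (fun _ => tt).

Definition Cell0 : Functor SET (gSet_ 0).
unshelve refine {| fob := set_glob0 : SET -> gSet_ 0 |}.
- by move=> V W f; exists (tt : @Hom terminal_cat tt tt) f.
- by move=> V; apply: ext_hom_ext.
- by move=> V W Z g f; apply: ext_hom_ext.
Defined.

Definition Cptd0 : Functor (gSet_ 0) SET.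
by refine {| fob := (fun X => top X) : gSet_ 0 -> SET; fmap := fun X Y f => htop f |}.
Defined.

Definition unit0 (X : gSet_ 0) : Hom X (set_glob0 (top X)).
refine (@Build_ext_hom (glob 0) X (set_glob0 (top X)) tt (fun x : top X => x) _).
by move=> x; case: (bdry x).
Defined.

Definition adj0 : Adjunction Cptd0 Cell0.
refine {| unit_ := unit0 : forall X : gSet_ 0, Hom X (Cell0 (Cptd0 X));
          counit := (fun V v => v) : forall V : SET, Hom (Cptd0 (Cell0 V)) V |} => //.
by move=> X Y f; apply: ext_hom_ext => //=; case: (hbase f).
Defined.

Definition Inv0 : Functor SET SET.
by refine {| fob := (fun _ => Empty_set) : SET -> SET; fmap := fun _ _ _ i => i |}.
Defined.

Definition Stage0 : Stage 0.
refine {|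
  iComp_ := SET; Cell_ := Cell0; Cptd_ := Cptd0; adj_ := adj0;
  Full_ := fun B p => src p = first (Pos B) /\ tgt p = last (Pos B);
  Inv_ := Inv0;
  fwd_ := fun _ i => match i with end;
  linv_ := fun _ i => match i with end;
  rinv_ := fun _ i => match i with end;
  lunit_bdry := fun _ i => match i with end;
  runit_bdry := fun _ i => match i with end
|}; by [].
Defined.

End Stage0.

Section Successor.
Context (n : nat) (L : Stage n).

Record icomp := {
  ctr : iComp_ L;
  V : Type;
  U : Type;
  phi : V -> Par (Cell_ L ctr);
  psi : U -> Par (Cell_ L ctr)
}.

Inductive inv (C : icomp) : Type :=
| igen (u : U C)
| lunit (i : Inv_ L (ctr C))
| runit (i : Inv_ L (ctr C)).

Definition ibdry (C : icomp) (i : inv C) : Par (Cell_ L (ctr C)) :=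
  match i with
  | igen u => psi u
  | lunit i => lunit_bdry i
  | runit i => runit_bdry i
  end.

(* The attaching function of the computad generated by the positions of [B]. *)
Definition pos_phi (B : tree) (p : Pos B (S n)) :
    Par (Cell_ L (Cptd_ L (trunc_ob (S n) (Pos B)))) :=
  fmap Par (unit_ (adj_ L) (trunc_ob (S n) (Pos B))) (trunc_bdry p).

(* The inductive-recursive definition of cells and morphisms is encoded by raw
   cells, whose boundary is computed without recursion, and a predicate [wf]
   imposing the boundary condition on the morphism [(fn, fV)] carried by each
   coherence cell.  That morphism has no component on invertible generators,
   since the computad generated by a globular set has none. *)
Inductive raw (C : icomp) : Type :=
| rgen (v : V C)
| rfwd (i : inv C)
| rlinv (i : inv C)
| rrinv (i : inv C)
| rcoh (B : tree) (dimB : dim B <= S n)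
       (A : Par (Cell_ L (Cptd_ L (trunc_ob (S n) (Pos B))))) (fullA : Full_ A)
       (fn : Hom (Cptd_ L (trunc_ob (S n) (Pos B))) (ctr C))
       (fV : Pos B (S n) -> raw C).

Definition raw_bdry (C : icomp) (c : raw C) : Par (Cell_ L (ctr C)) :=
  match c with
  | rgen v => phi v
  | rfwd i => ibdry i
  | rlinv i | rrinv i => par_op (ibdry i)
  | @rcoh _ B _ A _ fn _ => fmap Par (fmap (Cell_ L) fn) A
  end.

Fixpoint wf (C : icomp) (c : raw C) : Prop :=
  match c with
  | @rcoh _ B _ _ _ fn fV =>
      forall p, wf (fV p) /\ raw_bdry (fV p) = fmap Par (fmap (Cell_ L) fn) (pos_phi p)
  | _ => True
  end.

Fixpoint supp (C : icomp) (c : raw C) : V C + U C -> Prop :=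
  match c with
  | rgen v => fun g => g = inl v
  | rfwd i | rlinv i | rrinv i => fun g => match i with igen u => g = inr u | _ => False end
  | @rcoh _ B _ _ _ fn fV => fun g => exists p, supp (fV p) g
  end.

Record cells (C : icomp) := { rcell :> raw C; rcell_wf : wf rcell }.

Lemma cells_ext C (c d : cells C) : rcell c = rcell d -> c = d.
Proof.
  case: c => c pc; case: d => d pd /= e; subst d; by rewrite (proof_irrelevance _ pc pd).
Qed.

Definition gen C (v : V C) : cells C := {| rcell := rgen v; rcell_wf := Logic.I |}.
Definition fwd C (i : inv C) : cells C := {| rcell := rfwd i; rcell_wf := Logic.I |}.
Definition linv C (i : inv C) : cells C := {| rcell := rlinv i; rcell_wf := Logic.I |}.
Definition rinv C (i : inv C) : cells C := {| rcell := rrinv i; rcell_wf := Logic.I |}.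

Record icomp_hom (D C : icomp) := {
  fn_ : Hom (ctr D) (ctr C);
  fV_ : V D -> cells C;
  fU_ : U D -> inv C;
  fV_bdry : forall v, raw_bdry (fV_ v) = fmap Par (fmap (Cell_ L) fn_) (phi v);
  fU_bdry : forall u, ibdry (fU_ u) = fmap Par (fmap (Cell_ L) fn_) (psi u)
}.

Lemma icomp_hom_ext D C (f g : icomp_hom D C) : fn_ f = fn_ g ->
  (forall v, fV_ f v = fV_ g v) -> (forall u, fU_ f u = fU_ g u) -> f = g.
Proof.
  case: f => f fV fU pf qf; case: g => g gV gU pg qg /= e.
  move=> /functional_extensionality eV /functional_extensionality eU.
  subst g gV gU; by rewrite (proof_irrelevance _ pf pg) (proof_irrelevance _ qf qg).
Qed.

Lemma par_cellM (E D C : iComp_ L) (f : Hom D C) (g : Hom E D) (A : Par (Cell_ L E)) :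
  fmap Par (fmap (Cell_ L) (f ∘ g)) A =
  fmap Par (fmap (Cell_ L) f) (fmap Par (fmap (Cell_ L) g) A).
Proof. by rewrite !fmapM. Qed.

Definition inv_map D C (f : icomp_hom D C) (i : inv D) : inv C :=
  match i with
  | igen u => fU_ f u
  | lunit i => lunit (fmap (Inv_ L) (fn_ f) i)
  | runit i => runit (fmap (Inv_ L) (fn_ f) i)
  end.

Fixpoint raw_map D C (f : icomp_hom D C) (c : raw D) : raw C :=
  match c with
  | rgen v => fV_ f v
  | rfwd i => rfwd (inv_map f i)
  | rlinv i => rlinv (inv_map f i)
  | rrinv i => rrinv (inv_map f i)
  | @rcoh _ B dimB A fullA gn gV =>
      rcoh dimB fullA (fn_ f ∘ gn) (fun p => raw_map f (gV p))
  end.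

Lemma ibdry_map D C (f : icomp_hom D C) (i : inv D) :
  ibdry (inv_map f i) = fmap Par (fmap (Cell_ L) (fn_ f)) (ibdry i).
Proof.
  case: i => [u|i|i] /=; [exact: fU_bdry | exact: lunit_bdryN | exact: runit_bdryN].
Qed.

Lemma raw_bdry_map D C (f : icomp_hom D C) (c : raw D) :
  raw_bdry (raw_map f c) = fmap Par (fmap (Cell_ L) (fn_ f)) (raw_bdry c).
Proof.
  case: c => [v|i|i|i|B dimB A fullA gn gV] /=; rewrite ?ibdry_map //.
  - exact: fV_bdry.
  - exact: par_ext.
  - exact: par_ext.
  - exact: par_cellM.
Qed.

Lemma wf_map D C (f : icomp_hom D C) (c : raw D) : wf c -> wf (raw_map f c).
Proof.
  elim: c => [v|i|i|i|B dimB A fullA gn gV IH] //=; first by move=> _; exact: rcell_wf.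
  move=> wfg p; case: (wfg p) => wfp bp; split; first exact: IH.
  rewrite raw_bdry_map bp; exact: (eq_sym (par_cellM _ _ _)).
Qed.

Definition cells_map D C (f : icomp_hom D C) (c : cells D) : cells C :=
  {| rcell := raw_map f c; rcell_wf := wf_map f (rcell_wf c) |}.

Definition icomp_id (C : icomp) : icomp_hom C C.
refine {| fn_ := idm (ctr C); fV_ := @gen C; fU_ := @igen C |}; by move=> v; rewrite !fmap1.
Defined.

Definition icomp_comp E D C (f : icomp_hom D C) (g : icomp_hom E D) : icomp_hom E C.
refine {| fn_ := fn_ f ∘ fn_ g; fV_ := fun v => cells_map f (fV_ g v);
          fU_ := fun u => inv_map f (fU_ g u) |}.
- move=> v; rewrite raw_bdry_map fV_bdry; exact: (eq_sym (par_cellM _ _ _)).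
- move=> u; rewrite ibdry_map fU_bdry; exact: (eq_sym (par_cellM _ _ _)).
Defined.

Lemma inv_map_id C (i : inv C) : inv_map (icomp_id C) i = i.
Proof. by case: i => [u|i|i] //=; rewrite fmap1. Qed.

Lemma inv_map_comp E D C (f : icomp_hom D C) (g : icomp_hom E D) (i : inv E) :
  inv_map (icomp_comp f g) i = inv_map f (inv_map g i).
Proof. by case: i => [u|i|i] //=; rewrite fmapM. Qed.

Lemma raw_map_id C (c : raw C) : raw_map (icomp_id C) c = c.
Proof.
  elim: c => [v|i|i|i|B dimB A fullA gn gV IH] //=; rewrite ?inv_map_id //.
  rewrite comp1m; congr rcoh; exact: functional_extensionality.
Qed.

Lemma raw_map_comp E D C (f : icomp_hom D C) (g : icomp_hom E D) (c : raw E) :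
  raw_map (icomp_comp f g) c = raw_map f (raw_map g c).
Proof.
  elim: c => [v|i|i|i|B dimB A fullA gn gV IH] //=; rewrite ?inv_map_comp //.
  rewrite compmA; congr rcoh; exact: functional_extensionality.
Qed.

Definition iComp_succ : Category.
refine {| Ob := icomp; Hom := icomp_hom; idm := icomp_id; compm := icomp_comp |}.
- move=> W X Y Z h g f; apply: icomp_hom_ext => [|v|u] /=.
  + exact: compmA.
  + apply: cells_ext; by rewrite /= raw_map_comp.
  + by rewrite inv_map_comp.
- move=> X Y f; apply: icomp_hom_ext => [|v|u] //=; first exact: compm1.
  exact: cells_ext.
- move=> X Y f; apply: icomp_hom_ext => [|v|u] /=.
  + exact: comp1m.
  + apply: cells_ext; exact: raw_map_id.
  + exact: inv_map_id.
Defined.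

Definition cell_ob (C : icomp) : gSet_ (S n) :=
  @Build_ext (gSet_ n) (Cell_ L (ctr C)) (cells C) (fun c => raw_bdry c).

Definition cell_hom D C (f : icomp_hom D C) : Hom (cell_ob D) (cell_ob C) :=
  @Build_ext_hom (gSet_ n) (cell_ob D) (cell_ob C) (fmap (Cell_ L) (fn_ f)) (cells_map f)
    (fun c => raw_bdry_map f c).

Definition Cell_succ : Functor iComp_succ (gSet_ (S n)).
refine {| fob := cell_ob : iComp_succ -> gSet_ (S n); fmap := cell_hom |}.
- move=> C; apply: ext_hom_ext => [|c]; first exact: fmap1.
  apply: cells_ext; exact: raw_map_id.
- move=> E D C f g; apply: ext_hom_ext => [|c]; first exact: fmapM.
  apply: cells_ext; exact: raw_map_comp.
Defined.

Definition cptd_ob (X : gSet_ (S n)) : icomp := {|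
  ctr := Cptd_ L (base X);
  V := top X;
  U := Empty_set;
  phi := fun x => fmap Par (unit_ (adj_ L) (base X)) (bdry x);
  psi := fun u => match u with end
|}.

Definition cptd_hom (X Y : gSet_ (S n)) (h : Hom X Y) : icomp_hom (cptd_ob X) (cptd_ob Y).
refine (@Build_icomp_hom (cptd_ob X) (cptd_ob Y) (fmap (Cptd_ L) (hbase h))
          (fun x => @gen (cptd_ob Y) (htop h x)) (fun u => match u with end) _ _); last by case.
move=> x /=; rewrite hbdry.
move: (unitN (adj_ L) (hbase h)) => /(f_equal (fun k => fmap Par k (bdry x))).
by rewrite !fmapM.
Defined.

Definition Cptd_succ : Functor (gSet_ (S n)) iComp_succ.
refine {| fob := cptd_ob : gSet_ (S n) -> iComp_succ; fmap := cptd_hom |}.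
- move=> X; apply: icomp_hom_ext => [|v|[]] //=; exact: fmap1.
- move=> X Y Z g f; apply: icomp_hom_ext => [|v|[]] /=; first exact: fmapM.
  exact: cells_ext.
Defined.

Definition unit_succ (X : gSet_ (S n)) : Hom X (cell_ob (cptd_ob X)) :=
  @Build_ext_hom (gSet_ n) X (cell_ob (cptd_ob X)) (unit_ (adj_ L) (base X))
    (@gen (cptd_ob X)) (fun x => eq_refl).

Definition counit_succ (C : icomp) : icomp_hom (cptd_ob (cell_ob C)) C.
refine (@Build_icomp_hom (cptd_ob (cell_ob C)) C (counit (adj_ L) (ctr C))
          (fun c => c) (fun u => match u with end) _ _); last by case.
move=> c /=.
move: (triangleG (adj_ L) (ctr C)) => /(f_equal (fun k => fmap Par k (raw_bdry c))).
by rewrite !fmapM !fmap1.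
Defined.

Definition adj_succ : Adjunction Cptd_succ Cell_succ.
refine {| unit_ := unit_succ : forall X : gSet_ (S n), Hom X (Cell_succ (Cptd_succ X));
          counit := counit_succ |}.
- move=> X Y f; apply: ext_hom_ext => [|x]; first exact: unitN.
  exact: cells_ext.
- move=> C D f; apply: icomp_hom_ext => [|v|[]] /=; first exact: counitN.
  exact: cells_ext.
- move=> X; apply: icomp_hom_ext => [|v|[]] /=; first exact: triangleF.
  exact: cells_ext.
- move=> C; apply: ext_hom_ext => [|x]; first exact: triangleG.
  exact: cells_ext.
Defined.

Definition coh (B : tree) (dimB : dim B <= S n)
    (A : Par (Cell_ L (Cptd_ L (trunc_ob (S n) (Pos B))))) (fullA : Full_ A) (C : icomp)
    (f : Hom (Cptd_succ (trunc_ob (S (S n)) (Pos B))) (C : iComp_succ)) : cells C :=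
  {| rcell := rcoh dimB fullA (fn_ f) (fun p : Pos B (S n) => fV_ f p);
     rcell_wf := fun p => conj (rcell_wf (fV_ f p)) (fV_bdry f p) |}.

Definition Full_succ (B : tree)
    (p : Par (Cell_succ (Cptd_succ (trunc_ob (S (S n)) (Pos B))))) : Prop :=
  (forall g, supp (src p) g <-> exists y, g = inl (pos_src (S n) B (S n) y)) /\
  (forall g, supp (tgt p) g <-> exists y, g = inl (pos_tgt (S n) B (S n) y)) /\
  Full_ (s := L) (bdry (src p)).

Lemma Full_gen_succ B (a b : Pos B (S n)) (ab : trunc_bdry a = trunc_bdry b) : pos_full a b ->
  @Full_succ B (fmap Par (unit_ adj_succ (trunc_ob (S (S n)) (Pos B)))
    {| src := a : top (trunc_ob (S (S n)) (Pos B)); tgt := b; parE := ab |}).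
Proof.
  case=> Ha [Hb Hab]; split; [|split].
  - move=> [g|[]] /=; split.
    + by case=> ->; case: (proj1 (Ha a) eq_refl) => y e; exists y; rewrite -e.
    + by case=> y [e]; congr inl; apply/Ha; exists y.
  - move=> [g|[]] /=; split.
    + by case=> ->; case: (proj1 (Hb b) eq_refl) => y e; exists y; rewrite -e.
    + by case=> y [e]; congr inl; apply/Hb; exists y.
  - exact (@Full_gen n L B _ _ (trunc_bdryE a) Hab).
Qed.

Definition hat (X : gSet_ (S n)) (C : icomp) (h : Hom X (Cell_succ C)) :
    Hom (Cptd_succ X) (C : iComp_succ) :=
  counit adj_succ C ∘ fmap Cptd_succ h.

Lemma hat_nat (X : gSet_ (S n)) (D C : icomp) (f : icomp_hom D C) (h : Hom X (Cell_succ D)) :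
  (f : @Hom iComp_succ D C) ∘ hat h = hat (fmap Cell_succ f ∘ h).
Proof. by rewrite /hat compmA -counitN -compmA -fmapM. Qed.

Lemma hat_bdry (X : gSet_ (S n)) (C : icomp) (h : Hom X (Cell_succ C)) (p : Par (base X)) :
  fmap Par (fmap (Cell_ L) (fn_ (hat h))) (fmap Par (unit_ (adj_ L) (base X)) p) =
  fmap Par (hbase h) p.
Proof.
  have e : fmap (Cell_ L) (fn_ (hat h)) ∘ unit_ (adj_ L) (base X) = hbase h.
    have -> : fn_ (hat h) = counit (adj_ L) (ctr C) ∘ fmap (Cptd_ L) (hbase h) by [].
    by rewrite fmapM -compmA -unitN compmA triangleG comp1m.
  rewrite -e; exact: (eq_sym (f_equal (fun k => k p) (fmapM Par _ _))).
Qed.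

Lemma raw_map_coh (B : tree) (dimB : dim B <= S n)
    (A : Par (Cell_ L (Cptd_ L (trunc_ob (S n) (Pos B))))) (fullA : Full_ A) (D C : icomp)
    (f : icomp_hom D C) (h : Hom (trunc_ob (S (S n)) (Pos B)) (Cell_succ D)) :
  cells_map f (coh dimB fullA (hat h)) = coh dimB fullA (hat (fmap Cell_succ f ∘ h)).
Proof. rewrite -hat_nat; exact: cells_ext. Qed.

Definition disk_hat_map (C : icomp) (c : top (Cell_ L (ctr C))) :
    Hom (trunc_ob (S (S n)) (Pos (Dtree n))) (Cell_succ C) :=
  @Build_ext_hom (gSet_ n) (trunc_ob (S (S n)) (Pos (Dtree n))) (cell_ob C) (disk_map c)
    (fun x => match Dtree_above x with end) (fun x => match Dtree_above x with end).

Lemma disk_full : Full_ (s := L) (fmap Par (unit_ (adj_ L) (trunc_ob (S n) (Pos (Dtree n))))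
  {| src := d_top n : top (trunc_ob (S n) (Pos (Dtree n))); tgt := d_top n; parE := eq_refl |}).
Proof. exact: (@Full_gen _ L _ _ _ eq_refl (pos_full_d n)). Qed.

Lemma dim_Dtree_le : dim (Dtree n) <= S n.
Proof. by rewrite dim_Dtree; apply: Nat.le_succ_diag_r. Qed.

Definition ident (C : icomp) (c : top (Cell_ L (ctr C))) : cells C :=
  coh dim_Dtree_le disk_full (hat (disk_hat_map c)).

Lemma ident_bdry (C : icomp) (c : top (Cell_ L (ctr C))) :
  raw_bdry (ident c) = {| src := c; tgt := c; parE := eq_refl |}.
Proof. apply: (eq_trans (hat_bdry (disk_hat_map c) _)); exact: par_ext. Qed.

Lemma ident_map (D C : icomp) (f : icomp_hom D C) (c : top (Cell_ L (ctr D))) :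
  cells_map f (ident c) = ident (htop (fmap (Cell_ L) (fn_ f)) c).
Proof.
  rewrite /ident raw_map_coh; congr (coh _ _ (hat _)).
  apply: ext_hom_ext => [|x]; [exact: disk_map_nat | by case: (Dtree_above x)].
Qed.

Lemma pq_full : Full_ (s := L) (fmap Par (unit_ (adj_ L) (trunc_ob (S n) (Pos (Qtree n))))
  {| src := gs (p_top n) : top (trunc_ob (S n) (Pos (Qtree n))); tgt := gt (q_top n);
     parE := pq_par n |}).
Proof. exact: (@Full_gen _ L _ _ _ (pq_par n) (pos_full_pq n)). Qed.

Lemma dim_Qtree_le : dim (Qtree n) <= S n.
Proof. by rewrite dim_Qtree. Qed.

(* The composite [a * b], in diagrammatic order. *)
Definition comp2 (C : icomp) (a b : cells C) (ab : tgt (raw_bdry a) = src (raw_bdry b)) :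
    cells C :=
  coh dim_Qtree_le pq_full (hat (@pair_map n (Cell_succ C) a b ab)).

Lemma Q_obj_pq m : Q_obj (gs (p_top m)) = t0 /\ Q_obj (gt (q_top m)) = t2.
Proof. by elim: m. Qed.

Lemma comp2_bdry (C : icomp) (a b : cells C) (ab : tgt (raw_bdry a) = src (raw_bdry b)) :
  src (raw_bdry (comp2 ab)) = src (raw_bdry a) /\ tgt (raw_bdry (comp2 ab)) = tgt (raw_bdry b).
Proof.
  have -> : raw_bdry (comp2 ab) = fmap Par (@pair_map_base n (Cell_succ C) a b ab)
      {| src := gs (p_top n) : top (trunc_ob (S n) (Pos (Qtree n))); tgt := gt (q_top n);
         parE := pq_par n |}.
    exact: (hat_bdry (@pair_map n (Cell_succ C) a b ab) _).
  rewrite /=; by case: (Q_obj_pq n) => -> ->.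
Qed.

Lemma comp2_map (D C : icomp) (f : icomp_hom D C) (a b : cells D) (a' b' : cells C)
    (ab : tgt (raw_bdry a) = src (raw_bdry b)) (ab' : tgt (raw_bdry a') = src (raw_bdry b')) :
  a' = cells_map f a -> b' = cells_map f b -> comp2 ab' = cells_map f (comp2 ab).
Proof.
  move=> ea eb; subst a' b'; rewrite /comp2 raw_map_coh; congr (coh _ _ (hat _)).
  symmetry; exact: pair_map_nat.
Qed.

Lemma linv_fwd C (i : inv C) : tgt (raw_bdry (linv i)) = src (raw_bdry (fwd i)).
Proof. by []. Qed.

Lemma fwd_rinv C (i : inv C) : tgt (raw_bdry (fwd i)) = src (raw_bdry (rinv i)).
Proof. by []. Qed.

Definition lunit_bdry_succ (C : icomp) (i : inv C) : Par (Cell_succ C).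
refine {| src := comp2 (linv_fwd i) : top (Cell_succ C);
          tgt := ident (tgt (raw_bdry (fwd i))) |}.
rewrite [RHS]ident_bdry.
by apply: par_ext; [rewrite [LHS](proj1 (comp2_bdry _)) | rewrite [LHS](proj2 (comp2_bdry _))].
Defined.

Definition runit_bdry_succ (C : icomp) (i : inv C) : Par (Cell_succ C).
refine {| src := comp2 (fwd_rinv i) : top (Cell_succ C);
          tgt := ident (src (raw_bdry (fwd i))) |}.
rewrite [RHS]ident_bdry.
by apply: par_ext; [rewrite [LHS](proj1 (comp2_bdry _)) | rewrite [LHS](proj2 (comp2_bdry _))].
Defined.

Definition Inv_succ : Functor iComp_succ SET.
refine {| fob := inv : iComp_succ -> SET; fmap := inv_map |}.
- move=> C; apply: functional_extensionality; exact: inv_map_id.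
- move=> E D C f g; apply: functional_extensionality; exact: inv_map_comp.
Defined.

Definition Stage_succ : Stage (S n).
refine {|
  iComp_ := iComp_succ; Cell_ := Cell_succ; Cptd_ := Cptd_succ; adj_ := adj_succ;
  Full_ := Full_succ;
  Inv_ := Inv_succ;
  fwd_ := fwd : forall C, Inv_succ C -> top (Cell_succ C);
  linv_ := linv : forall C, Inv_succ C -> top (Cell_succ C);
  rinv_ := rinv : forall C, Inv_succ C -> top (Cell_succ C);
  lunit_bdry := lunit_bdry_succ; runit_bdry := runit_bdry_succ;
  Full_gen := Full_gen_succ
|}.
- move=> D C f i; apply: par_ext => /=; first by apply: comp2_map; exact: cells_ext.
  by rewrite ident_map ibdry_map.
- move=> D C f i; apply: par_ext => /=; first by apply: comp2_map; exact: cells_ext.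
  by rewrite ident_map ibdry_map.
- by move=> D C f i; exact: cells_ext.
- by move=> D C f i; exact: cells_ext.
- by move=> D C f i; exact: cells_ext.
Defined.

End Successor.

Fixpoint stage (n : nat) : Stage n :=
  match n with 0 => Stage0 | S n => Stage_succ (stage n) end.

Definition iCompn (n : nat) : Category := iComp_ (stage n).
Definition Celln (n : nat) : Functor (iCompn n) (gSet_ n) := Cell_ (stage n).
Definition Cptdn (n : nat) : Functor (gSet_ n) (iCompn n) := Cptd_ (stage n).
Definition adjn (n : nat) : Adjunction (Cptdn n) (Celln n) := adj_ (stage n).

Definition iComp_trunc (n : nat) : Functor (iCompn (S n)) (iCompn n).
refine {| fob := @ctr n (stage n) : iCompn (S n) -> iCompn n;
          fmap := @fn_ n (stage n) |}; by [].
Defined.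

Definition idtohom (A : Category) (X Y : A) (e : X = Y) : Hom X Y :=
  match e with eq_refl => idm X end.

Lemma idtohomK (A : Category) (X Y : A) (e : X = Y) :
  idtohom e ∘ idtohom (eq_sym e) = idm Y /\ idtohom (eq_sym e) ∘ idtohom e = idm X.
Proof. case: Y / e => /=; by rewrite comp1m. Qed.

Record computad := {
  cn :> forall n, iCompn n;
  cnE : forall n, iComp_trunc n (cn (S n)) = cn n
}.

(* Objects agree up to the equalities [cnE], so the compatibility of the
   components of a morphism is stated up to the corresponding identities. *)
Record computad_hom (C D : computad) := {
  hn :> forall n, Hom (C n) (D n);
  hnE : forall n,
    idtohom (cnE D n) ∘ fmap (iComp_trunc n) (hn (S n)) = hn n ∘ idtohom (cnE C n)
}.

Lemma computad_hom_ext C D (f g : computad_hom C D) : (forall n, f n = g n) -> f = g.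
Proof.
  case: f => f pf; case: g => g pg /= e.
  have {}e : f = g by exact: functional_extensionality_dep.
  subst g; by rewrite (proof_irrelevance _ pf pg).
Qed.

Definition iComp : Category.
refine {| Ob := computad; Hom := computad_hom |}.
Unshelve.
all: cycle 3.
- move=> C; exists (fun n => idm (C n)) => n; by rewrite fmap1 compm1 comp1m.
- move=> C D E g f; exists (fun n => g n ∘ f n) => n.
  by rewrite fmapM compmA hnE -compmA hnE compmA.
- move=> *; apply: computad_hom_ext => n; exact: compmA.
- move=> *; apply: computad_hom_ext => n; exact: compm1.
- move=> *; apply: computad_hom_ext => n; exact: comp1m.
Defined.

Definition Cell_top (n : nat) (C : iCompn n) : Type := top (Celln n C).

Definition Cell_bdry (C : computad) (n : nat) (c : Cell_top (C (S n))) : par (Celln n (C n)) :=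
  fmap Par (fmap (Celln n) (idtohom (cnE C n))) (@bdry (gSet_ n) (Celln (S n) (C (S n))) c).

Lemma Cell_bdryE (C : computad) n (c : Cell_top (C (S (S n)))) :
  Cell_bdry (src (Cell_bdry c)) = Cell_bdry (tgt (Cell_bdry c)).
Proof. by rewrite {1 3}/Cell_bdry (parE (Cell_bdry c)). Qed.

Definition Cell_ob (C : computad) : gset.
refine {| cell := fun n => Cell_top (C n);
          gs := fun n c => src (Cell_bdry c);
          gt := fun n c => tgt (Cell_bdry c) |}.
- move=> n c; by rewrite Cell_bdryE.
- move=> n c; by rewrite Cell_bdryE.
Defined.

Lemma Cell_bdry_hom (C D : computad) (f : computad_hom C D) n (c : Cell_top (C (S n))) :
  Cell_bdry (htop (fmap (Celln (S n)) (f (S n))) c) =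
  fmap Par (fmap (Celln n) (f n)) (Cell_bdry c).
Proof.
  rewrite /Cell_bdry.
  have -> : bdry (htop (fmap (Celln (S n)) (f (S n))) c) =
    fmap Par (fmap (Celln n) (fmap (iComp_trunc n) (f (S n)))) (bdry c) by exact: hbdry.
  have ParM (X Y Z : iCompn n) (h : Hom Y Z) (k : Hom X Y) (p : Par (Celln n X)) :
    fmap Par (fmap (Celln n) h) (fmap Par (fmap (Celln n) k) p) =
    fmap Par (fmap (Celln n) (h ∘ k)) p by rewrite !fmapM.
  by rewrite !ParM hnE.
Qed.

Definition Cell_hom (C D : computad) (f : computad_hom C D) : gset_hom (Cell_ob C) (Cell_ob D).
refine (@Build_gset_hom (Cell_ob C) (Cell_ob D) (fun n => htop (fmap (Celln n) (f n))) _ _).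
- move=> n c; exact: (f_equal (@src (glob n) _) (eq_sym (Cell_bdry_hom f c))).
- move=> n c; exact: (f_equal (@tgt (glob n) _) (eq_sym (Cell_bdry_hom f c))).
Defined.

Definition Cell : Functor iComp gSet.
refine {| fob := Cell_ob : iComp -> gSet; fmap := Cell_hom |}.
- move=> C; apply: gset_hom_ext => n c /=; by rewrite fmap1.
- move=> C D E g f; apply: gset_hom_ext => n c /=; by rewrite fmapM.
Defined.

Definition Cptd_ob (X : gset) : computad :=
  {| cn := fun n => Cptdn n (trunc_ob (S n) X); cnE := fun n => eq_refl |}.

Definition Cptd_hom (X Y : gset) (h : gset_hom X Y) : computad_hom (Cptd_ob X) (Cptd_ob Y).
refine (@Build_computad_hom (Cptd_ob X) (Cptd_ob Y)
          (fun n => fmap (Cptdn n) (fmap (trunc (S n)) (h : @Hom gSet X Y))) _).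
move=> n; by rewrite comp1m compm1.
Defined.

Definition Cptd : Functor gSet iComp.
refine {| fob := Cptd_ob : gSet -> iComp; fmap := Cptd_hom |}.
- move=> X; apply: computad_hom_ext => n.
  exact: (eq_trans (f_equal (fun k => fmap (Cptdn n) k) (fmap1 (trunc (S n)) X))
                   (fmap1 (Cptdn n) _)).
- move=> X Y Z g f; apply: computad_hom_ext => n.
  exact: (eq_trans (f_equal (fun k => fmap (Cptdn n) k)
                      (fmapM (trunc (S n)) (g : @Hom gSet Y Z) (f : @Hom gSet X Y)))
                   (fmapM (Cptdn n) _ _)).
Defined.

Lemma Cell_bdry_unit (X : gset) n (x : X (S n)) :
  Cell_bdry (C := Cptd_ob X) (htop (unit_ (adjn (S n)) (trunc_ob (S (S n)) X)) x) =
  fmap Par (unit_ (adjn n) (trunc_ob (S n) X)) (trunc_bdry x).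
Proof. rewrite /Cell_bdry /= fmap1; exact: par_ext. Qed.

Definition unit_hom (X : gset) : gset_hom X (Cell_ob (Cptd_ob X)).
refine (@Build_gset_hom X (Cell_ob (Cptd_ob X))
          (fun n => htop (unit_ (adjn n) (trunc_ob (S n) X))) _ _).
- move=> n x; exact: (f_equal (@src (glob n) _) (eq_sym (Cell_bdry_unit x))).
- move=> n x; exact: (f_equal (@tgt (glob n) _) (eq_sym (Cell_bdry_unit x))).
Defined.

(* The truncation of [Cell C] is isomorphic to the cells of the truncation of [C],
   by a map that is the identity on [n]-cells. *)
Definition trunc_Cell_data (C : computad) (n : nat) : Type :=
  {k : ext_hom (trunc_ob (S n) (Cell_ob C)) (Celln n (C n)) |
   forall x : Cell_ob C n, htop k x = x}.

Definition trunc_Cell0 (C : computad) : trunc_Cell_data C 0.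
exists (@Build_ext_hom (glob 0) (trunc_ob 1 (Cell_ob C)) (Celln 0 (C 0)) tt (fun x => x)
          (fun x => eq_refl)).
by [].
Defined.

Definition trunc_Cell_base (C : computad) (n : nat) (d : trunc_Cell_data C n) :
    Hom (trunc_ob (S n) (Cell_ob C)) (Celln n (iComp_trunc n (C (S n)))) :=
  fmap (Celln n) (idtohom (eq_sym (cnE C n))) ∘ (proj1_sig d : Hom (_ : gSet_ n) _).

Lemma trunc_Cell_baseE (C : computad) (n : nat) (d : trunc_Cell_data C n) (x : Cell_top (C (S n))) :
  @bdry (gSet_ n) (Celln (S n) (C (S n))) x =
  fmap Par (trunc_Cell_base d) (@trunc_bdry (S n) (Cell_ob C) x).
Proof.
  have -> : fmap Par (trunc_Cell_base d) (@trunc_bdry (S n) (Cell_ob C) x) =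
    fmap Par (fmap (Celln n) (idtohom (eq_sym (cnE C n)))) (Cell_bdry x).
    rewrite /trunc_Cell_base fmapM; apply: (f_equal (fmap Par _)).
    apply: par_ext; exact: (proj2_sig d).
  rewrite /Cell_bdry; set b := bdry x.
  have e : fmap (Celln n) (idtohom (eq_sym (cnE C n))) ∘ fmap (Celln n) (idtohom (cnE C n)) = idm _.
    by rewrite -fmapM (proj2 (idtohomK _)) fmap1.
  by move: (f_equal (fun k => fmap Par k b) e); rewrite fmapM fmap1.
Qed.

Definition trunc_Cell_step (C : computad) (n : nat) (d : trunc_Cell_data C n) :
  trunc_Cell_data C (S n).
exists (@Build_ext_hom (gSet_ n) (trunc_ob (S (S n)) (Cell_ob C)) (Celln (S n) (C (S n)))
          (trunc_Cell_base d) (fun x => x) (trunc_Cell_baseE d)).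
by [].
Defined.

Fixpoint trunc_Cell_rec (C : computad) (n : nat) : trunc_Cell_data C n :=
  match n with
  | 0 => trunc_Cell0 C
  | S n => trunc_Cell_step (trunc_Cell_rec C n)
  end.

Definition trunc_Cell (C : computad) (n : nat) :
    Hom (trunc_ob (S n) (Cell_ob C)) (Celln n (C n)) :=
  proj1_sig (trunc_Cell_rec C n).

Lemma trunc_Cell_nat (C D : computad) (f : computad_hom C D) n :
  trunc_Cell D n ∘ fmap (trunc (S n)) (Cell_hom f : @Hom gSet _ _) =
  fmap (Celln n) (f n) ∘ trunc_Cell C n.
Proof.
  elim: n => [|n IH].
  - apply: ext_hom_ext => //; by case: (hbase _) (hbase _).
  - apply: ext_hom_ext => //.
    change (fmap (Celln n) (idtohom (eq_sym (cnE D n))) ∘ trunc_Cell D n ∘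
              fmap (trunc (S n)) (Cell_hom f : @Hom gSet _ _) =
            fmap (Celln n) (fmap (iComp_trunc n) (f (S n))) ∘
              (fmap (Celln n) (idtohom (eq_sym (cnE C n))) ∘ trunc_Cell C n)).
    rewrite -compmA IH !compmA -!fmapM; congr (fmap _ _ ∘ _).
    rewrite -[RHS]comp1m -(proj2 (idtohomK (cnE D n))) -[RHS]compmA (compmA (idtohom (cnE D n))).
    by rewrite hnE -compmA (proj1 (idtohomK _)) compm1.
Qed.

Lemma trunc_Cell_unit (X : gset) n :
  trunc_Cell (Cptd_ob X) n ∘ fmap (trunc (S n)) (unit_hom X : @Hom gSet _ _) =
  unit_ (adjn n) (trunc_ob (S n) X).
Proof.
  elim: n => [|n IH].
  - apply: ext_hom_ext => //; by case: (hbase _) (hbase _).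
  - apply: ext_hom_ext => //.
    change (fmap (Celln n) (idm _) ∘ trunc_Cell (Cptd_ob X) n ∘
              fmap (trunc (S n)) (unit_hom X : @Hom gSet _ _) =
            unit_ (adjn n) (trunc_ob (S n) X)).
    by rewrite fmap1 comp1m.
Qed.

Definition counit_hom (C : computad) : computad_hom (Cptd_ob (Cell_ob C)) C.
refine (@Build_computad_hom (Cptd_ob (Cell_ob C)) C
          (fun n => counit (adjn n) (C n) ∘ fmap (Cptdn n) (trunc_Cell C n)) _).
move=> n.
change (idtohom (cnE C n) ∘ (counit (adjn n) (iComp_trunc n (C (S n))) ∘
          fmap (Cptdn n) (fmap (Celln n) (idtohom (eq_sym (cnE C n))) ∘ trunc_Cell C n)) =
        counit (adjn n) (C n) ∘ fmap (Cptdn n) (trunc_Cell C n) ∘ idm _).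
rewrite fmapM compm1 (compmA (counit _ _)) counitN !compmA.
by rewrite (proj1 (idtohomK _)) comp1m.
Defined.

Definition adj : Adjunction Cptd Cell.
refine {| unit_ := unit_hom : forall X : gSet, Hom X (Cell (Cptd X));
          counit := counit_hom : forall C : iComp, Hom (Cptd (Cell C)) C |}.
- move=> X Y f; apply: gset_hom_ext => n x.
  exact (f_equal (fun k : ext_hom _ _ => @htop (glob n) (trunc_ob (S n) X) _ k x)
           (unitN (adjn n) (fmap (trunc (S n)) f))).
- move=> C D f; apply: computad_hom_ext => n.
  change (counit (adjn n) (D n) ∘ fmap (Cptdn n) (trunc_Cell D n) ∘
            fmap (Cptdn n) (fmap (trunc (S n)) (Cell_hom f : @Hom gSet _ _)) =
          hn f n ∘ (counit (adjn n) (C n) ∘ fmap (Cptdn n) (trunc_Cell C n))).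
  by rewrite -compmA -fmapM trunc_Cell_nat fmapM !compmA counitN.
- move=> X; apply: computad_hom_ext => n.
  change (counit (adjn n) (Cptdn n (trunc_ob (S n) X)) ∘
            fmap (Cptdn n) (trunc_Cell (Cptd_ob X) n) ∘
            fmap (Cptdn n) (fmap (trunc (S n)) (unit_hom X : @Hom gSet _ _)) = idm _).
  by rewrite -compmA -fmapM trunc_Cell_unit triangleF.
- move=> C; apply: gset_hom_ext => n x.
  change (htop (fmap (Celln n) (counit (adjn n) (C n) ∘ fmap (Cptdn n) (trunc_Cell C n)))
            (htop (unit_ (adjn n) (trunc_ob (S n) (Cell_ob C))) x) = x).
  have e : fmap (Celln n) (counit (adjn n) (C n) ∘ fmap (Cptdn n) (trunc_Cell C n)) ∘
             unit_ (adjn n) (trunc_ob (S n) (Cell_ob C)) = trunc_Cell C n.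
    by rewrite fmapM -compmA -unitN compmA triangleG comp1m.
  rewrite -[RHS](proj2_sig (trunc_Cell_rec C n)).
  exact (f_equal (fun k : ext_hom _ _ => @htop (glob n) (trunc_ob (S n) (Cell_ob C)) _ k x) e).
Defined.

Definition ordinary (C : iComp) : Prop := forall m, U (cn C (S m)) -> False.

Definition Comp : Category := full_subcategory ordinary.

Definition Comp_inclusion : Functor Comp iComp := inclusion ordinary.

Definition T : Monad gSet := adj_monad adj.

Definition Cat_omega : Category := algebras T.

Definition K : Functor iComp Cat_omega := comparison adj.

(* Main.v *)
(* Since [Cptd X] has no invertible generators, a morphism [Cptd X -> C] factors
   uniquely through the counit [RC -> C] of the coreflection.  By adjunction, a map
   [X -> Cell C] factors uniquely through [Cell (RC) -> Cell C], which is therefore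
   an isomorphism (Yoneda); the forgetful functor from algebras reflects isomorphisms. *)
From Stdlib Require Import ssreflect.
Require Import Defs.

Set Implicit Arguments.
Unset Strict Implicit.
Unset Printing Implicit Defensive.

Lemma algebra_isomorphic (A : Category) (M : Monad A) (X Y : Algebra M)
    (f : AlgebraHom X Y) (g : Hom (carrier Y) (carrier X)) :
  g ∘ ahom f = idm _ -> ahom f ∘ g = idm _ -> @isomorphic (algebras M) Y X.
Proof.
  move=> gf fg.
  have gE : g ∘ action Y = action X ∘ fmap M g.
    (* Insert the identity [ahom f ∘ g] under [M], slide the action past [ahom f], then cancel with
       [gf]. *)
    rewrite -[action Y]compm1 -(fmap1 M) -fg fmapM (compmA (action Y)) -ahomE.
    by rewrite !compmA gf comp1m.
  exists (Build_AlgebraHom gE), f; split; exact: AlgebraHom_ext.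
Qed.

Lemma transpose_inj (A B : Category) (F : Functor A B) (G : Functor B A)
    (adj : Adjunction F G) (X : A) (Y : B) (f g : Hom X (G Y)) :
  counit adj Y ∘ fmap F f = counit adj Y ∘ fmap F g -> f = g.
Proof.
  have tK (h : Hom X (G Y)) : fmap G (counit adj Y ∘ fmap F h) ∘ unit_ adj X = h.
    by rewrite fmapM -compmA -unitN compmA triangleG comp1m.
  by move=> e; rewrite -[f]tK e tK.
Qed.

Section Coreflection.
Context (A B : Category) (F : Functor A B) (G : Functor B A) (adj : Adjunction F G).
Context (P : B -> Prop) (R : Functor B (full_subcategory P)).
Context (adjR : Adjunction (inclusion P) R) (FP : forall X, P (F X)).

Lemma coreflection_factor (X : A) (C : B) (f : Hom (F X) C) :
  exists h : Hom (F X) (inclusion P (R C)), counit adjR C ∘ h = f.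
Proof.
  (* [FP] places [F X] in the subcategory, so [h] can be the transpose of [f] under [adjR]. *)
  pose FX : full_subcategory P := exist _ (F X) (FP X).
  exists (fmap R (f : Hom (inclusion P FX) C) ∘ unit_ adjR FX).
  have e := counitN adjR (f : Hom (inclusion P FX) C).
  have t := triangleF adjR FX.
  rewrite /= in e t.
  by rewrite /= compmA e -compmA t compm1.
Qed.

Lemma coreflection_inj (X : A) (C : B) (f g : Hom (F X) (inclusion P (R C))) :
  counit adjR C ∘ f = counit adjR C ∘ g -> f = g.
Proof. exact: (@transpose_inj _ _ _ _ adjR (exist _ (F X) (FP X)) C f g). Qed.

Lemma comparison_coreflection (C : B) :
  isomorphic (comparison adj C) (comparison adj (inclusion P (R C))).
Proof.
  have [h hE] := coreflection_factor (counit adj C).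
  (* The candidate inverse is the transpose of [h], the lift of [counit adj C]; one composite is a
     triangle identity. *)
  have fg : fmap G (counit adjR C) ∘ (fmap G h ∘ unit_ adj (G C)) = idm _.
    by rewrite compmA -fmapM hE triangleG.
  apply: (@algebra_isomorphic _ _ _ _ (comparison_hom adj (counit adjR C))
            (fmap G h ∘ unit_ adj (G C))) => //=.
  (* The other composite is compared with the identity after transposing and applying
     [counit adjR C]; naturality of [counit adj] then reduces it to [fg]. *)
  apply: (transpose_inj (adj := adj)); apply: coreflection_inj.
  by rewrite !compmA -counitN -!(compmA (counit adj C)) -!fmapM compmA fg comp1m compm1.
Qed.

End Coreflection.

Theorem corollary4p5 (R : Functor iComp Comp) (adjR : Adjunction Comp_inclusion R) (C : iComp) :
  @isomorphic Cat_omega (K C) (K (Comp_inclusion (R C))).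
(* Each [U] of [Cptd X] is [Empty_set] by computation. *)
Proof. by apply: (comparison_coreflection adj adjR) => X m []. Qed.
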